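(* Let $L=(L,\wedge,\vee,1,0)$ be a complete lattice and $X\subseteq L\setminus\{1\}$ a subset such that $L$ is an $X$-top lattice, and equip $X$ with its Zariski-like topology. The following are equivalent: (1) $X$ is $T_{\frac34}$; (2) $X=\mathrm{Max}(X)\cup RO(X)$; (3) $X=\mathrm{Max}(X)\cup(\mathrm{Iso}(X)\cap\mathcal E(X))$; (4) $X=\mathrm{Max}(X)\cup(\mathrm{Min}(X)\cap CSI^X(X)\cap\mathcal E(X))$.
   Context: For a complete lattice $L=(L,\wedge,\vee,1,0)$, $X\subseteq L\setminus\{1\}$ and $a\in L$, put $V(a)=\{x\in X: a\le x\}$ and $D(a)=X\setminus V(a)$. $L$ is an $X$-top lattice iff the family $\{V(a):a\in L\}$ is closed under finite unions (it always contains $X=V(0)$, $\emptyset=V(1)$ and is closed under arbitrary intersections); then the sets $D(a)$, $a\in L$, are the open sets of a topology on $X$, called the Zariski-like topology. $X$ is a poset with the order of $L$; $\mathrm{Max}(X)$, $\mathrm{Min}(X)$ are its sets of maximal and minimal elements. Meets are taken in $L$ and the empty meet is $1$. $RO(X)=\{x\in X:\{x\}=\mathrm{int}(\overline{\{x\}})\}$ (regular open points); $\mathrm{Iso}(X)=\{x\in X:\{x\}\text{ is open}\}$; $\mathcal E(X)=\{x\in X: \bigwedge_{y\in X\setminus\{x\}}y=\bigwedge_{y\in D(x)}y\}$ (excluded points); $CSI^X(X)$ is the set of $q\in X$ such that for every $A\subseteq X$, $\bigwedge_{a\in A}a\le q$ implies $a\le q$ for some $a\in A$. A topological space $X$ is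 $T_{\frac34}$ iff for every $x\in X$, $\{x\}$ is closed or $\{x\}=\mathrm{int}(\overline{\{x\}})$. *)

(* Defs.v *)
From HB Require Import structures.
From mathcomp Require Import all_boot all_order.
From mathcomp Require Import boolp classical_sets topology.

Set Implicit Arguments.
Unset Strict Implicit.
Unset Printing Implicit Defensive.
Import Order.TTheory.
Local Open Scope order_scope.
Local Open Scope classical_set_scope.

Definition complete_lattice (d : Order.disp_t) (L : tbLatticeType d) : Prop :=
  forall A : set L, supremums A !=set0 /\ infimums A !=set0.

(* The first argument of [infimum] is its value on the empty set, so the empty
   meet is \top; [bigmeet] is only meaningful when L is complete. *)
Definition bigmeet (d : Order.disp_t) (L : tbLatticeType d) (A : set L) : L :=
  infimum \top A.

Definition max_points (d : Order.disp_t) (P : porderType d) : set P :=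
  [set x | forall y : P, x <= y -> y = x].
Arguments max_points {d} P.

Definition min_points (d : Order.disp_t) (P : porderType d) : set P :=
  [set x | forall y : P, y <= x -> y = x].
Arguments min_points {d} P.

Definition regular_open_points (T : topologicalType) : set T :=
  [set x | [set x] = (closure [set x])°].
Arguments regular_open_points T : clear implicits.

Definition isolated_points (T : topologicalType) : set T :=
  [set x | open [set x]].
Arguments isolated_points T : clear implicits.

Definition T_three_quarter (T : topologicalType) : Prop :=
  forall x : T, closed [set x] \/ [set x] = (closure [set x])°.

Definition variety (d : Order.disp_t) (L : tbLatticeType d) (X : set L)
    (a : L) : set (set_type X) :=
  [set x | a <= val x].

(* The empty union is [variety X \top] when \top is not in X, so binary unions
   suffice. *)
Definition top_lattice (d : Order.disp_t) (L : tbLatticeType d) (X : set L)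
    : Prop :=
  setU_closed (range (variety (X := X))).

(* The subset X as a type of points. The hypotheses are carried along because
   the sets [covariety X a] below form a topology only in their presence. *)
Definition zariski (d : Order.disp_t) (L : tbLatticeType d) (X : set L)
    (cL : complete_lattice L) (X1 : X `<=` [set~ \top]) (tX : top_lattice X)
    : Type :=
  set_type X.

Section ZariskiTopology.
Context (d : Order.disp_t) (L : tbLatticeType d) (X : set L).
Context (cL : complete_lattice L) (X1 : X `<=` [set~ \top]).
Context (tX : top_lattice X).
Local Notation Z := (zariski cL X1 tX).

HB.instance Definition _ := SubChoice.on Z.
HB.instance Definition _ := [SubChoice_isSubPOrder of Z by <: with d].

Definition covariety (a : L) : set Z := ~` variety (X := X) a.

Let opT : range covariety setT.
Proof.
exists \top => //; apply/seteqP; split=> // x _.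
by rewrite /covariety /variety /= le1x => /eqP; exact: X1 (set_valP x).
Qed.

Let opI : setI_closed (range covariety).
Proof.
move=> _ _ [a _ <-] [b _ <-].
have [|| c _ Vc] := @tX (variety a) (variety b); [by exists a|by exists b|].
by exists c => //; rewrite /covariety Vc setCU.
Qed.

Let op_bigU (I : Type) (f : I -> set Z) :
  (forall i, range covariety (f i)) -> range covariety (\bigcup_i f i).
Proof.
move=> fD.
have /choice[a fa] : forall i, exists a, f i = covariety a.
  by move=> i; have [a _ <-] := fD i; exists a.
have [[s [ubs lbs]] _] := cL (range a).
exists s => //; apply/seteqP; split=> x /=.
  move=> nsx; apply: contrapT => nfx; apply: nsx; apply: lbs => _ [i _ <-].
  apply: contrapT => nax; apply: nfx; exists i => //.
  by rewrite fa.
case=> i _; rewrite fa => nax sx; apply: nax.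
by apply: le_trans sx; apply: ubs; exists i.
Qed.

HB.instance Definition _ := isOpenTopological.Build Z opT opI op_bigU.

Definition excluded_points : set Z :=
  [set x | bigmeet (val @` [set~ x]) = bigmeet (val @` covariety (val x))].

Definition CSI_points : set Z :=
  [set q | forall A : set Z,
     bigmeet (val @` A) <= val q -> exists2 a, A a & val a <= val q].

Lemma open_zariskiE : @open Z = range covariety.
Proof. by []. Qed.

End ZariskiTopology.

Arguments excluded_points {d L X} cL X1 tX.
Arguments CSI_points {d L X} cL X1 tX.

(* Main.v *)
(** The closure of a set of points is the variety of its meet, so the closed
    points are the maximal ones. Hence [int (closure {x})] is the complement of
    the closure of [D(x)], and comparing this with the complement of the closure
    of [X \ {x}] gives [RO(X) = Iso(X) ∩ E(X)]. Finally [{x}] is open iff [x]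
    does not lie above the meet of [X \ {x}], which gives
    [Iso(X) = Min(X) ∩ CSI(X)]. *)
Require Import Defs.
From mathcomp Require Import all_boot all_order.
From mathcomp Require Import boolp classical_sets topology.
Import Order.TTheory.
Local Open Scope order_scope.
Local Open Scope classical_set_scope.

(** [infimum] picks an infimum by choice and falls back on a default; completeness makes one exist,
    so for nonempty [A] the default never occurs. *)
Lemma bigmeet_le (d : Order.disp_t) (L : tbLatticeType d)
    (cL : complete_lattice L) (A : set L) (a : L) :
  A a -> bigmeet A <= a.
Proof.
move=> Aa; rewrite /bigmeet /infimum; case: ifPn => [/eqP A0|_].
  by rewrite A0 in Aa.
by case: xgetP => [m _ [lbA _]|/(_ _) noinf]; [exact: lbA
  | have [_ [m /noinf]] := cL A].
Qed.

Lemma le_bigmeet (d : Order.disp_t) (L : tbLatticeType d)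
    (cL : complete_lattice L) (A : set L) (b : L) :
  (forall a, A a -> b <= a) -> b <= bigmeet A.
Proof.
move=> bA; rewrite /bigmeet /infimum; case: ifPn => [_|_]; first exact: lex1.
by case: xgetP => [m _ [_ glb]|/(_ _) noinf]; [exact: glb
  | have [_ [m /noinf]] := cL A].
Qed.

Section ZariskiPoints.
Context (d : Order.disp_t) (L : tbLatticeType d) (X : set L).
Context (cL : complete_lattice L) (X1 : X `<=` [set~ \top]).
Context (tX : top_lattice X).
Local Notation Z := (zariski cL X1 tX).
Implicit Types (x y : Z) (A : set Z).

Let meet A : L := bigmeet (val @` A).

Lemma closed_zariskiP A :
  closed A <-> exists a : L, A = [set x : Z | a <= val x].
Proof.
split=> [|[a ->]].
  rewrite -openC open_zariskiE => -[a _ Ea]; exists a.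
  by rewrite -[LHS]setCK -Ea /covariety setCK.
by rewrite -openC open_zariskiE; exists a.
Qed.

(** A closed set given by [b] contains [A] iff [b] is a lower bound of [A], and the greatest such
    [b] gives the smallest closed set. *)
Lemma closure_zariski A : closure A = [set x : Z | meet A <= val x].
Proof.
apply/seteqP; split.
  rewrite closureE; apply: smallest_sub.
    by apply/closed_zariskiP; exists (meet A).
  by move=> x Ax /=; apply: bigmeet_le => //; exists x.
move=> x /= Ax; rewrite closureE => B [/closed_zariskiP[b ->] AB] /=.
by apply: le_trans Ax; apply: le_bigmeet => // _ [y /AB yb <-].
Qed.

Lemma closure_point x : closure [set x] = [set y : Z | val x <= val y].
Proof.
rewrite closure_zariski; apply/funext => y /=; congr (is_true (_ <= _)).
apply/le_anti/andP; split; first by apply: bigmeet_le => //; exists x.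
by apply: le_bigmeet => // _ [z -> <-].
Qed.

(** The closure of a point is its up-set in [X], which is a singleton exactly at maximal points. *)
Lemma max_points_closed : max_points Z = [set x | closed [set x]].
Proof.
apply/seteqP; split=> x /=.
  move=> xmax; apply/closed_zariskiP; exists (val x).
  apply/seteqP; split=> y /= => [->//|xy]; exact: xmax.
move=> /closure_id clx y xy.
suff : [set x] y by [].
by rewrite clx closure_point.
Qed.

Lemma isolated_pointsE :
  isolated_points Z = [set x | ~ (meet [set~ x] <= val x)].
Proof.
apply/seteqP; split=> x /=.
  rewrite /isolated_points /= -closedC => /closure_id.
  by rewrite closure_zariski => /seteqP[_ /(_ x) /=] h /h; apply.
move=> nx; rewrite /isolated_points /= -closedC.
apply/closed_zariskiP; exists (meet [set~ x]).
apply/seteqP; split=> y /= h; first by apply: bigmeet_le => //; exists y.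
by move=> yx; apply: nx; move: h; rewrite yx.
Qed.

Lemma interior_closure_point x :
  (closure [set x])° = [set y : Z | ~ (meet (covariety (val x)) <= val y)].
Proof.
have -> : closure [set x] = ~` (covariety (val x) : set Z).
  by rewrite closure_point /covariety setCK.
by rewrite interiorC closure_zariski.
Qed.

Lemma regular_open_pointsE :
  regular_open_points Z = isolated_points Z `&` excluded_points cL X1 tX.
Proof.
apply/seteqP; split=> x /=; rewrite /regular_open_points /=.
  move=> xE; split; first by rewrite /isolated_points /= xE; exact: open_interior.
  rewrite interior_closure_point in xE.
  apply/le_anti/andP; split; apply: le_bigmeet => // _ [y yx <-].
    by apply: bigmeet_le => //; exists y => // yEx; apply: yx; rewrite yEx; exact: lexx.
  (* A point of [X] not above the meet of [D(x)] lies in the interior of the closure of [x], which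
     is [{x}]. *)
  apply: contrapT => my; apply: yx.
  suff : [set x] y by [].
  by rewrite xE.
rewrite isolated_pointsE interior_closure_point => -[nx xexcl].
(* Once the two meets agree, every point other than [x] lies above the meet of [D(x)], while [x]
   itself does not. *)
rewrite /meet -xexcl; apply/seteqP; split=> y /= => [->//|ny].
by apply: contrapT => yx; apply: ny; apply: bigmeet_le => //; exists y.
Qed.

Lemma isolated_pointsE_min_CSI :
  isolated_points Z = min_points Z `&` CSI_points cL X1 tX.
Proof.
rewrite isolated_pointsE; apply/seteqP; split=> x /=.
  move=> nx; split=> [y yx|A Ax]; apply: contrapT => h; apply: nx.
    apply: (@le_trans _ _ (val y)); last exact: yx.
    by apply: bigmeet_le => //; exists y.
  (* If no member of [A] is below [x], then [x] is not in [A], so the meet of all points other than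
     [x] is below that of [A]. *)
  apply: le_trans Ax; apply: le_bigmeet => // _ [y Ay <-].
  apply: bigmeet_le => //; exists y => // yx.
  by apply: h; exists y => //; rewrite yx.
(* Taking [A] to be all points other than [x] yields some [y] below [x] and distinct from it,
   against minimality. *)
by move=> [xmin xCSI] /xCSI[y yx] /xmin.
Qed.

End ZariskiPoints.

Theorem theorem3p19 (d : Order.disp_t) (L : tbLatticeType d) (X : set L)
    (cL : complete_lattice L)
    (X1 : X `<=` [set~ Order.top])
    (tX : top_lattice X) :
  let Z := zariski cL X1 tX in
  [<-> T_three_quarter Z;
       [set: Z] = max_points Z `|` regular_open_points Z;
       [set: Z] = max_points Z
         `|` (isolated_points Z `&` excluded_points cL X1 tX);
       [set: Z] = max_points Z
         `|` (min_points Z `&` CSI_points cL X1 tX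
              `&` excluded_points cL X1 tX)].
Proof.
(* These identities turn the last two conditions into the second, which, with closed points for
   maximal ones, is [T_three_quarter] read pointwise. *)
move=> Z; rewrite -isolated_pointsE_min_CSI -regular_open_pointsE.
rewrite max_points_closed; tfae=> //.
  by move=> T34; apply/seteqP; split=> // x _; exact: T34.
move=> ZE x.
suff : [set: Z] x by rewrite ZE.
by [].
Qed.
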